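(* Up to a dilation, every rational flat $n$-torus admits a minimal isometric immersion into some sphere. That is, if $\mathbb{R}^n/\Lambda_n$ is a rational flat $n$-torus, then there exist $\lambda>0$ and a positive integer $m$ such that the flat torus $\mathbb{R}^n/\lambda\Lambda_n$ admits a minimal isometric immersion into the unit round sphere $\mathbb{S}^m$.
   Context: A flat $n$-torus is $\mathbb{R}^n/\Lambda_n$ with the metric induced from the Euclidean metric, where $\Lambda_n\subset\mathbb{R}^n$ is a lattice of rank $n$. If the rows of the matrix $L_n$ form a basis of $\Lambda_n$, the Gram matrix of $\Lambda_n$ is $Q=L_nL_n^t$. The flat torus $\mathbb{R}^n/\Lambda_n$ is called rational if, up to a dilation (i.e. up to multiplication by a positive real number), its Gram matrix $Q$ has only rational entries. Spheres are unit round spheres $\mathbb{S}^m\subset\mathbb{R}^{m+1}$. *)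

(* Defs.v *)
From HB Require Import structures.
From mathcomp Require Import all_boot all_order all_algebra generic_quotient.
From mathcomp Require Import all_classical all_reals all_analysis.
Import Order.TTheory GRing.Theory Num.Theory.
Import numFieldNormedType.Exports.

Set Implicit Arguments.
Unset Strict Implicit.
Unset Printing Implicit Defensive.

Local Open Scope ring_scope.
Local Open Scope classical_set_scope.
Local Open Scope quotient_scope.

(* Vectors are rows; the Euclidean structure of 'rV[R]_n is carried by dotv,
   since the library norm on matrices is the sup norm (it is only used here
   for the topology and the differential calculus). *)

Section FlatTori.
Variables (R : realType) (n : nat).

Definition lattice_basis (L : 'M[R]_n) (Lam : zmodClosed 'rV[R]_n) : Prop :=
  L \in unitmx /\
  forall v : 'rV[R]_n,
    v \in Lam <-> exists z : 'rV[int]_n, v = map_mx intr z *m L.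

Definition is_lattice (Lam : zmodClosed 'rV[R]_n) : Prop :=
  exists L : 'M[R]_n, lattice_basis L Lam.

Definition gram (L : 'M[R]_n) : 'M[R]_n := L *m L^T.

(* Replacing Lam by a *: Lam multiplies the Gram matrix by a ^+ 2, so the
   factor c ranges over the Gram matrices of all the dilations of Lam.  The
   choice of the basis is immaterial: two Gram matrices of Lam are congruent
   over the integers. *)
Definition rational_lattice (Lam : zmodClosed 'rV[R]_n) : Prop :=
  exists2 L : 'M[R]_n, lattice_basis L Lam &
  exists2 c : R, 0 < c &
  exists A : 'M[rat]_n, c *: gram L = map_mx ratr A.

Definition dilation (lam : R) (Lam : zmodClosed 'rV[R]_n) : {pred 'rV[R]_n} :=
  fun v => `[< exists2 u, u \in Lam & v = lam *: u >].

Lemma dilation_zmod_closed lam Lam : zmod_closed (dilation lam Lam).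
Proof.
split; first by apply/asboolP; exists 0; rewrite ?rpred0 ?scaler0.
move=> _ _ /asboolP[u uL ->] /asboolP[v vL ->]; apply/asboolP.
by exists (u - v); rewrite ?rpredB ?scalerBr.
Qed.

HB.instance Definition _ lam Lam :=
  GRing.isZmodClosed.Build 'rV[R]_n (dilation lam Lam)
    (dilation_zmod_closed lam Lam).

Section Torus.
Variable Lam : zmodClosed 'rV[R]_n.

Definition congr_lattice (x y : 'rV[R]_n) : bool := (x - y) \in Lam.

Lemma congr_lattice_equiv : equiv_class_of congr_lattice.
Proof.
split=> [x|x y|y x z]; rewrite /congr_lattice.
- by rewrite subrr rpred0.
- by rewrite -opprB rpredN.
- by move=> xy yz; rewrite -(subrKA y) rpredD.
Qed.

Canonical congr_lattice_equiv_rel :=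
  EquivRelPack congr_lattice_equiv.

Definition flat_torus : Type := {eq_quot congr_lattice}.

Definition torus_proj (x : 'rV[R]_n) : flat_torus := \pi_{eq_quot congr_lattice} x.

End Torus.
End FlatTori.

Section MinimalImmersions.
Variable R : realType.

Definition dotv n (u v : 'rV[R]_n) : R := (u *m v^T) 0 0.

Definition unit_sphere m : set 'rV[R]_m.+1 := [set y | dotv y y = 1].

Arguments unit_sphere : clear implicits.

Fixpoint is_Ck (k n p : nat) (F : 'rV[R]_n -> 'rV[R]_p) : Prop :=
  if k is k'.+1 then
    (forall x, differentiable F x) /\ forall v, is_Ck k' ('D_v F)
  else continuous F.

Definition smooth n p (F : 'rV[R]_n -> 'rV[R]_p) : Prop :=
  forall k, is_Ck k F.

(* In this section F is a (local) parametrization, by R^n, of an immersed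
   submanifold of the unit sphere S^m; row i of the library's Jacobian 'J F x
   is the i-th partial derivative of F at x. *)
Section Immersion.
Variables (n m : nat) (F : 'rV[R]_n -> 'rV[R]_m.+1).

Definition immersion : Prop := forall x, row_free ('J F x).

Definition induced_metric (x : 'rV[R]_n) : 'M[R]_n := 'J F x *m ('J F x)^T.

(* Orthogonal projection onto the normal space at x of the immersion into the
   sphere, i.e. onto the orthogonal complement in R^(m+1) of F x (the normal
   line of the sphere) and of the tangent space (the row space of 'J F x,
   which is orthogonal to F x). *)
Definition normal_part (x : 'rV[R]_n) (w : 'rV[R]_m.+1) : 'rV[R]_m.+1 :=
  w - dotv w (F x) *: F x
    - w *m ('J F x)^T *m invmx (induced_metric x) *m 'J F x.

(* The Levi-Civita connection of the sphere is the tangential part of the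
   derivative of R^(m+1), so the second fundamental form in the sphere is the
   normal part of the second derivative. *)
Definition second_fundamental_form (x u v : 'rV[R]_n) : 'rV[R]_m.+1 :=
  normal_part x ('D_u ('D_v F) x).

(* Normalized trace of the second fundamental form for the induced metric. *)
Definition mean_curvature (x : 'rV[R]_n) : 'rV[R]_m.+1 :=
  n%:R^-1 *: \sum_(i < n) \sum_(j < n)
    invmx (induced_metric x) i j *:
      second_fundamental_form x (delta_mx 0 i) (delta_mx 0 j).

End Immersion.

(* A map on the torus is smooth iff its lift to R^n is, and all the conditions
   below are local.  In the coordinates of R^n the metric of the torus is the
   identity matrix. *)
Definition minimal_isometric_immersion n m (Lam : zmodClosed 'rV[R]_n)
    (f : flat_torus Lam -> 'rV[R]_m.+1) : Prop :=
  let F := f \o torus_proj Lam in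
  [/\ range f `<=` unit_sphere m,
      smooth F,
      immersion F,
      forall x, induced_metric F x = 1%:M
    & forall x, mean_curvature F x = 0].

End MinimalImmersions.

(* Main.v *)
(* A map x |-> (a_j cos <k_j, x>, a_j sin <k_j, x>)_j on R^n is isometric iff
   \sum_j a_j^2 k_j^T k_j = 1; if moreover |k_j|^2 = n for all j, then its
   coordinates are eigenfunctions of the Laplacian for the eigenvalue n, so that
   it is a minimal map into the unit sphere (Takahashi).  It is thus enough to
   find, up to dilation, vectors k_j of equal length in the dual lattice such
   that some nonnegative combination of the k_j^T k_j is the identity.  A
   rational Gram matrix can be diagonalized over the rationals into a form with
   coefficients d_i, and one may take, for all i, the vectors
   c_i e_0 +/- t_i e_i where (c_i, t_i) is a rational point of the ellipse
   d_0 c^2 + d_i t^2 = d_0 close enough to the second axis; clearing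
   denominators puts these vectors in the dual lattice, up to dilation. *)

Require Import Defs.
From HB Require Import structures.
From mathcomp Require Import all_boot all_order all_algebra generic_quotient.
From mathcomp Require Import ring lra.
From mathcomp Require Import all_classical all_reals all_analysis.
Import Order.TTheory GRing.Theory Num.Theory.
Import numFieldNormedType.Exports.
Local Open Scope ring_scope.

Set Implicit Arguments.
Unset Strict Implicit.
Unset Printing Implicit Defensive.

(** * Calculus of trigonometric maps *)

Lemma periodic_int (U V : zmodType) (f : U -> V) (T : U) :
  periodic f T -> forall (z : int) a, f (a + T *~ z) = f a.
Proof.
move=> fT [] m a; first by rewrite -pmulrn periodicn.
by rewrite NegzE mulrNz -pmulrn -[in RHS](subrK (T *+ m.+1) a) periodicn.
Qed.

Section Waves.
Variables (R : realType) (n p : nat) (K : 'M[R]_(n, p)).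

(* The phases make this class of maps stable under differentiation. *)
Definition wave (a phi : 'rV[R]_p) (x : 'rV[R]_n) : 'rV[R]_p :=
  \row_j (a 0 j * cos ((x *m K + phi) 0 j)).

Let phase (phi : 'rV[R]_p) j (x : 'rV[R]_n) : R := (x *m K + phi) 0 j.

Let phaseE phi j :
  phase phi j =
  (\sum_(i < n) (fun x : 'rV[R]_n => K i j *: (x 0 i : R))) + cst (phi 0 j).
Proof.
apply/funext => x; rewrite /phase !mxE !fctE fct_sumE; congr (_ + _).
by apply: eq_bigr => i _; rewrite mulrC.
Qed.

Let phase_differentiable phi j x : differentiable (phase phi j) x.
Proof.
rewrite phaseE; apply: differentiableD; last exact: differentiable_cst.
apply: differentiable_sum => i; apply: differentiableZ.
exact: differentiable_coord.
Qed.

Let coord_derive (i : 'I_n) (x v : 'rV[R]_n) :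
  'D_v (fun y : 'rV[R]_n => y 0 i : R) x = v 0 i.
Proof.
have /(congr1 (fun w : 'rV[R]_n => w 0 i)) :=
  derive_mx (@derivable_id R 'rV[R]_n x v).
by rewrite derive_id mxE => ->.
Qed.

Let phase_derive phi j x v : 'D_v (phase phi j) x = (v *m K) 0 j.
Proof.
have dK i : derivable (fun y : 'rV[R]_n => K i j *: (y 0 i : R)) x v.
  by apply/derivableZ/diff_derivable/differentiable_coord.
rewrite phaseE deriveD; [|exact: derivable_sum|exact: derivable_cst].
rewrite derive_sum// derive_cst addr0 mxE; apply: eq_bigr => i _.
rewrite deriveZ ?coord_derive; first by rewrite mulrC.
exact/diff_derivable/differentiable_coord.
Qed.

Let cos_phase_differentiable phi j x :
  differentiable (fun y => cos (phase phi j y)) x.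
Proof.
apply: (@differentiable_comp _ _ _ _ (phase phi j) (@cos R)) => //.
exact/derivable1_diffP/derivable_cos.
Qed.

Let cos_phase_derive phi j x v :
  'D_v (fun y => cos (phase phi j y)) x = - (v *m K) 0 j * sin (phase phi j x).
Proof.
have dcos : derivable (@cos R) (phase phi j x) 1 by exact: derivable_cos.
rewrite deriveE// (@diff_comp _ _ _ _ (phase phi j) (@cos R))//; last first.
  exact/derivable1_diffP.
rewrite /= deriv1E// derive1E derive_val -(phase_derive phi j x v) deriveE//.
by rewrite /GRing.scale/= mulrN mulNr.
Qed.

Let waveE a phi :
  wave a phi = \sum_(j < p) 
    (fun x : 'rV[R]_n => cos (phase phi j x) *: (a 0 j *: delta_mx 0 j)).
Proof.
apply/funext => x; rewrite fct_sumE [LHS]row_sum_delta.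
by apply: eq_bigr => j _; rewrite mxE mulrC scalerA.
Qed.

Lemma wave_differentiable a phi x : differentiable (wave a phi) x.
Proof.
by rewrite waveE; apply: differentiable_sum => j; apply: differentiableZl.
Qed.

(** Since [- sin y = cos (y + pi / 2)], differentiating only rescales the amplitudes and shifts
    every phase by a quarter turn. *)
Lemma wave_derive a phi v x :
  'D_v (wave a phi) x =
  wave (\row_j (a 0 j * (v *m K) 0 j)) (phi + const_mx (pi / 2)) x.
Proof.
rewrite derive_mx; last exact/diff_derivable/wave_differentiable.
apply/rowP => j; rewrite !mxE.
under eq_fun do rewrite mxE.
have dc := diff_derivable (v := v) (cos_phase_differentiable phi j x).
rewrite (deriveZ (a 0 j) dc) cos_phase_derive addrA cosDpihalf /phase !mxE.
by rewrite /GRing.scale/= mulNr mulrN mulrA mulrN.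
Qed.

Lemma wave_smooth a phi : smooth (wave a phi).
Proof.
move=> k; elim: k a phi => [|k IH] a phi /=.
  by move=> x; exact/differentiable_continuous/wave_differentiable.
split=> [x|v]; first exact: wave_differentiable.
by under eq_fun do rewrite wave_derive.
Qed.

Lemma wave_jacobian a phi x :
  'J (wave a phi) x =
  \matrix_(i, j) (- a 0 j * K i j * sin ((x *m K + phi) 0 j)).
Proof.
apply/row_matrixP => i; rewrite rowE -deriveEjacobian; last first.
  exact: wave_differentiable.
rewrite wave_derive -rowE; apply/rowP => j; rewrite !mxE addrA cosDpihalf.
by rewrite mulrN !mulNr.
Qed.

Lemma wave_derive2 a phi x u v :
  'D_u ('D_v (wave a phi)) x =
  \row_j (- (a 0 j * (u *m K) 0 j * (v *m K) 0 j * cos ((x *m K + phi) 0 j))).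
Proof.
under eq_fun do rewrite wave_derive.
rewrite wave_derive; apply/rowP => j; rewrite !mxE.
rewrite !addrA cosDpihalf sinDpihalf mulrN.
by congr (- (_ * _)); rewrite mulrAC.
Qed.

End Waves.

(** * Minimal immersions of tori into products of circles *)

(* Takahashi's criterion in flat coordinates: the trace of the second derivative
   is proportional to [F x], hence normal to the sphere. *)
Lemma minimal_of_laplacian (R : realType) (n m : nat)
    (F : 'rV[R]_n -> 'rV[R]_m.+1) (x : 'rV[R]_n) :
  dotv (F x) (F x) = 1 -> induced_metric F x = 1%:M ->
  F x *m ('J F x)^T = 0 ->
  \sum_(i < n) 'D_(delta_mx 0 i) ('D_(delta_mx 0 i) F) x = - n%:R *: F x ->
  mean_curvature F x = 0.
Proof.
move=> F1 FI FJ FL; rewrite /mean_curvature FI invmx1.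
have normal_sum (G : 'I_n -> 'rV[R]_m.+1) :
    \sum_i normal_part F x (G i) = normal_part F x (\sum_i G i).
  rewrite /normal_part /dotv !sumrB !mulmx_suml summxE scaler_suml.
  by congr (_ - _ - _).
under eq_bigr => i _.
  rewrite (bigD1 i)//= big1 ?addr0 => [|j ji]; last first.
    by rewrite mxE eq_sym (negPf ji) scale0r.
  rewrite mxE eqxx scale1r.
  over.
rewrite normal_sum FL /normal_part -!scalemxAl FJ !mul0mx scaler0 subr0.
by rewrite /dotv -scalemxAl mxE -/(dotv _ _) F1 mulr1 subrr scaler0.
Qed.

Section CircleWaves.
Variables (R : realType) (n p : nat) (K : 'M[R]_(n, p)) (a : 'rV[R]_p).

(** The phase [- (pi / 2)] turns the second block of cosines into sines. The frequency vectors are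
    the columns of [K], and being a [wave] the map inherits the derivative formulas above. *)
Definition circle_wave : 'rV[R]_n -> 'rV[R]_(p + p) :=
  wave (row_mx K K) (row_mx a a) (row_mx 0 (const_mx (- (pi / 2)))).

Lemma circle_waveE x :
  circle_wave x = row_mx (\row_j (a 0 j * cos ((x *m K) 0 j)))
                         (\row_j (a 0 j * sin ((x *m K) 0 j))).
Proof.
rewrite /circle_wave /wave mul_mx_row add_row_mx addr0; apply/rowP => j.
rewrite mxE; case: (split_ordP j) => k ->.
  by rewrite !row_mxEl [RHS]mxE.
by rewrite !row_mxEr [RHS]mxE [X in cos X]mxE [const_mx _ _ _]mxE cosBpihalf.
Qed.

Lemma circle_wave_jacobian x :
  'J circle_wave x =
  row_mx (\matrix_(i, j) (- a 0 j * K i j * sin ((x *m K) 0 j)))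
         (\matrix_(i, j) (a 0 j * K i j * cos ((x *m K) 0 j))).
Proof.
rewrite wave_jacobian mul_mx_row add_row_mx addr0; apply/matrixP => i j.
rewrite mxE; case: (split_ordP j) => k ->.
  by rewrite !row_mxEl [RHS]mxE.
rewrite !row_mxEr [RHS]mxE [X in sin X]mxE [const_mx _ _ _]mxE sinBpihalf.
by rewrite mulrN !mulNr opprK.
Qed.

Lemma circle_wave_dot x :
  dotv (circle_wave x) (circle_wave x) = \sum_j a 0 j ^+ 2.
Proof.
rewrite /dotv circle_waveE tr_row_mx mul_row_col !mxE -big_split /=.
apply: eq_bigr => j _.
rewrite !mxE -(mulr1 (a 0 j ^+ 2)) -(cos2Dsin2 ((x *m K) 0 j)).
by rewrite !mxE; ring.
Qed.

Lemma circle_wave_metric x :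
  'J circle_wave x *m ('J circle_wave x)^T =
  \matrix_(i, i') \sum_j a 0 j ^+ 2 * K i j * K i' j.
Proof.
rewrite circle_wave_jacobian tr_row_mx mul_row_col.
apply/matrixP => i i'; rewrite !mxE -big_split /=; apply: eq_bigr => j _.
rewrite !mxE -(mulr1 (_ ^+ 2 * _ * _)) -(cos2Dsin2 ((x *m K) 0 j)).
by rewrite !mxE; ring.
Qed.

Lemma circle_wave_orthogonal x : circle_wave x *m ('J circle_wave x)^T = 0.
Proof.
rewrite circle_wave_jacobian circle_waveE tr_row_mx mul_row_col.
apply/rowP => i; rewrite !mxE -big_split /= big1 // => j _.
by rewrite !mxE; ring.
Qed.

Lemma circle_wave_laplacian (c : R) x :
  (forall j, \sum_i K i j ^+ 2 = c) ->
  \sum_(i < n) 'D_(delta_mx 0 i) ('D_(delta_mx 0 i) circle_wave) x =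
  - c *: circle_wave x.
Proof.
move=> Kc; under eq_bigr do rewrite wave_derive2 -!rowE.
apply/rowP => j; rewrite summxE !mxE.
have <- : \sum_i row_mx K K i j ^+ 2 = c.
  case: (split_ordP j) => k ->; rewrite -(Kc k);
  by apply: eq_bigr => i _; rewrite ?row_mxEl ?row_mxEr.
rewrite mulNr mulr_suml -sumrN; apply: eq_bigr => i _.
by rewrite !mxE; congr (- _); rewrite !mulrA; congr (_ * _); ring.
Qed.

End CircleWaves.

(** The three conditions on [K] and [a] give, in order, the isometry, the Laplace eigenvalue [n],
    and the periodicity that makes the map descend to the torus. *)
Lemma circle_wave_minimal_isometric_immersion (R : realType) (n p : nat)
    (Lam : zmodClosed 'rV[R]_n) (K : 'M[R]_(n, p.+1)) (a : 'rV[R]_p.+1) :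
  (0 < n)%N ->
  (forall i i', \sum_j a 0 j ^+ 2 * K i j * K i' j = (i == i')%:R) ->
  (forall j, \sum_i K i j ^+ 2 = n%:R) ->
  (forall v, v \in Lam -> forall j,
     exists z : int, (v *m K) 0 j = pi *+ 2 *~ z) ->
  exists f : flat_torus Lam -> 'rV[R]_(p + p.+1).+1,
    minimal_isometric_immersion f.
Proof.
move=> n_gt0 aK Kn KLam.
(* Take the trace of the isometry condition: each frequency has squared length [n], so [n] times the
   sum of the [a 0 j ^+ 2] equals [n]. *)
have a1 : \sum_j a 0 j ^+ 2 = 1.
  have n_neq0 : n%:R != 0 :> R by rewrite pnatr_eq0 -lt0n.
  apply: (mulIf n_neq0); rewrite mul1r mulr_suml.
  under eq_bigr => j _ do rewrite -(Kn j) mulr_sumr.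
  rewrite exchange_big /= -[in RHS](card_ord n) -sumr_const.
  apply: eq_bigr => i _; have := aK i i; rewrite eqxx mulr1n => <-.
  by apply: eq_bigr => j _; rewrite mulrA.
(* The type is accepted because [(p + p.+1).+1] is convertible to [p.+1 + p.+1]. *)
pose F : 'rV[R]_n -> 'rV[R]_(p + p.+1).+1 := circle_wave K a.
pose f (t : flat_torus Lam) := F (repr t).
have fF : f \o torus_proj Lam = F.
  apply/funext => x; rewrite /f /F /= !circle_waveE.
  have /KLam per : congr_lattice Lam (repr (torus_proj Lam x)) x.
    by apply/(@eqquotP _ (congr_lattice Lam)); exact: reprK.
  set y := repr _ in per *.
  have -> : y *m K = x *m K + (y - x) *m K by rewrite -mulmxDl addrC subrK.
  congr (row_mx (_ : 'rV_p.+1) _); apply/rowP => j; rewrite [LHS]mxE [RHS]mxE;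
    congr (_ * _); have [z perj] := per j; rewrite [(x *m K + _) 0 j]mxE perj.
    by rewrite (periodic_int (@cosD2pi R)).
  by rewrite (periodic_int (@sinD2pi R)).
have FI x : induced_metric F x = 1%:M.
  rewrite /induced_metric /F (circle_wave_metric K a x).
  by apply/matrixP => i i'; rewrite !mxE aK.
have F1 x : dotv (F x) (F x) = 1 by rewrite -a1 -(circle_wave_dot K a x).
exists f; rewrite /minimal_isometric_immersion fF; split.
- by move=> _ [t _ <-]; exact: F1.
- exact: wave_smooth.
- by move=> x; apply/row_freeP; exists ('J F x)^T; exact: FI.
- exact: FI.
- move=> x; apply: minimal_of_laplacian => //.
    exact: (circle_wave_orthogonal K a x).
  exact: (circle_wave_laplacian a x Kn).
Qed.

(** * Diagonalization of positive definite forms over an ordered field *)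

(** Gaussian elimination by congruence: only division by the positive pivots occurs, no square root,
    so that the result applies over the rationals. *)
Lemma posdef_diagonalization (F : realFieldType) (n : nat) (A : 'M[F]_n) :
  A^T = A -> (forall x : 'rV[F]_n, x != 0 -> 0 < (x *m A *m x^T) 0 0) ->
  exists (P : 'M[F]_n) (d : 'rV[F]_n),
    [/\ P \in unitmx, forall i, 0 < d 0 i & P *m A *m P^T = diag_mx d].
Proof.
elim: n A => [|n IH] A sA pA.
  exists 1%:M, 0; split; rewrite ?unitmx1 //; first by case.
  by apply/matrixP => -[].
rewrite -[n.+1]/(1 + n)%N in A sA pA *.
pose a := A 0 0.
have a_gt0 : 0 < a.
  have := pA (delta_mx 0 0); rewrite -rowE trmx_delta -colE !mxE; apply.
  by apply/eqP => /rowP/(_ 0)/eqP; rewrite !mxE !eqxx oner_eq0.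
have a_neq0 : a != 0 by rewrite gt_eqF.
pose b : 'rV[F]_n := ursubmx A.
pose D : 'M[F]_n := drsubmx A.
have AE : A = block_mx a%:M b b^T D.
  rewrite -[A in LHS]submxK; congr block_mx.
    apply/matrixP => i j; rewrite !ord1 !mxE /a.
    by congr (A _ _); apply: val_inj.
  by rewrite /b trmx_ursub sA.
(* [Q] clears the first row and column; [S] is the Schur complement of the pivot [a]. *)
pose Q : 'M[F]_(1 + n) := block_mx 1%:M 0 (- a^-1 *: b^T) 1%:M.
pose S := D - a^-1 *: (b^T *m b).
have QAE : Q *m A *m Q^T = block_mx a%:M 0 0 S.
  rewrite AE /Q tr_block_mx !mulmx_block !trmx1 !trmx0 !mul1mx !mulmx1.
  rewrite !mul0mx !mulmx0 !addr0 linearZ /= trmxK.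
  rewrite mul_scalar_mx -!scalemxAl mul_mx_scalar !scalerA mulNr mulVf //.
  rewrite scaleN1r addNr mul0mx add0r mulrN mulfV // scaleN1r addNr.
  by congr block_mx; rewrite addrC scaleNr.
have QAEc p (r : 'M[F]_(p, 1 + n)) :
    r *m Q *m A *m (r *m Q)^T = r *m block_mx a%:M 0 0 S *m r^T.
  by rewrite trmx_mul -QAE !mulmxA.
have Q_unit : Q \in unitmx.
  by rewrite unitmxE det_lblock !det1 mulr1 unitr1.
have sS : S^T = S.
  have : (Q *m A *m Q^T)^T = Q *m A *m Q^T by rewrite !trmx_mul trmxK sA mulmxA.
  by rewrite QAE tr_block_mx => /eq_block_mx[].
(* The form [S] at [x] is the form [A] at [row_mx 0 x *m Q]. *)
have pS (x : 'rV[F]_n) : x != 0 -> 0 < (x *m S *m x^T) 0 0.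
  move=> x_neq0; have := pA (row_mx 0 x *m Q).
  rewrite QAEc tr_row_mx mul_row_block mul_row_col trmx0.
  rewrite !(add0r, mul0mx, mulmx0).
  rewrite mul_mx_row mulmx0 mul_row_col mul0mx add0r mulmx1.
  by apply; apply: contra_neq x_neq0; rewrite -row_mx0 => /eq_row_mx[].
have [P [d [P_unit d_gt0 PE]]] := IH S sS pS.
exists (block_mx 1%:M 0 0 P *m Q), (row_mx a%:M d : 'rV[F]_(1 + n)); split.
- by rewrite unitmx_mul Q_unit andbT unitmxE det_lblock det1 mul1r -unitmxE.
- move=> i; case: (@split_ordP 1 n i) => k ->; last by rewrite row_mxEr.
  by rewrite row_mxEl ord1 mxE eqxx.
- rewrite QAEc tr_block_mx !mulmx_block.
  rewrite diag_mx_row !mul1mx !mul0mx !mulmx0 !addr0 !add0r trmx1 !trmx0.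
  rewrite !mulmx1 !mul0mx !mulmx0 PE.
  rewrite !add0r addr0; congr block_mx.
  by apply/matrixP => i j; rewrite !ord1 !mxE.
Qed.

(** * Rational and integral designs *)

(* [R] only serves to find a rational number between two square roots. *)
Lemma rational_ellipse_point (R : realType) (q e : rat) : 0 < q -> 0 < e ->
  exists c t : rat, c ^+ 2 + q * t ^+ 2 = 1 /\ c ^+ 2 <= e.
Proof.
(* A rational slope [s] is chosen with [1 < q * s ^+ 2 < 1 + e], that is, with [s] between the
   square roots of [x] and [y]. *)
move=> q_gt0 e_gt0; pose x : R := ratr q^-1; pose y : R := ratr ((1 + e) / q).
have x_gt0 : 0 < x by rewrite ltr0q invr_gt0.
have lt_xy : x < y by rewrite ltr_rat ltr_pMl ?invr_gt0 // ltrDl.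
have := lt_xy; rewrite -ltr_sqrt ?(lt_trans x_gt0) // => /rat_in_itvoo[s].
rewrite in_itv /= => /andP[xs sy].
have s_gt0 : 0 < ratr s :> R by apply: le_lt_trans xs; exact: sqrtr_ge0.
have xs2 : q^-1 < s ^+ 2.
  rewrite -(ltr_rat R) rmorphXn /= -/x -(sqr_sqrtr (ltW x_gt0)).
  by rewrite ltr_pXn2r // nnegrE ?sqrtr_ge0 ?ltW.
have sy2 : s ^+ 2 < (1 + e) / q.
  rewrite -(ltr_rat R) rmorphXn /= -/y.
  rewrite -(sqr_sqrtr (ltW (lt_trans x_gt0 lt_xy))).
  by rewrite ltr_pXn2r // nnegrE ?sqrtr_ge0 ?ltW.
pose u := q * s ^+ 2.
have u_gt1 : 1 < u by rewrite /u mulrC -ltr_pdivrMr // div1r.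
have u_lt : u < 1 + e by rewrite /u mulrC -ltr_pdivlMr.
have u1_gt0 : 0 < 1 + u by lra.
(* Second intersection of the ellipse with the line of slope [s] through [(-1, 0)]; [c] is small
   because [u] is close to 1. *)
exists ((1 - u) / (1 + u)), (2 * s / (1 + u)); split.
  have -> : q * (2 * s / (1 + u)) ^+ 2 = 4 * u / (1 + u) ^+ 2.
    by rewrite {2}/u; field; rewrite gt_eqF.
  by field; rewrite gt_eqF.
rewrite expr_div_n ler_pdivrMr ?exprn_gt0 //.
nra.
Qed.

(** The rows of [Y] are vectors of equal length for the form [d], and the last identity says that
    their weighted sum of squares is a multiple of the inverse form. *)
Lemma diagonal_design (R : realType) (n : nat) (d : 'rV[rat]_n.+1) :
  (forall i, 0 < d 0 i) ->
  exists (p : nat) (Y : 'M[rat]_(p, n.+1)) (w : 'rV[rat]_p),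
    [/\ (0 < p)%N, forall j, 0 <= w 0 j,
        forall j, (Y *m diag_mx d *m Y^T) j j = d 0 0
      & Y^T *m diag_mx w *m Y *m diag_mx d = (d 0 0 / n.+1%:R)%:M].
Proof.
move=> d_gt0.
have N_gt0 : 0 < n.+1%:R :> rat by rewrite ltr0n.
have N_neq0 : n.+1%:R != 0 :> rat by rewrite gt_eqF.
have d_neq0 i : d 0 i != 0 by rewrite gt_eqF.
(* The bound [n.+1%:R^-1] on [c ^+ 2] makes each of the [n] weights off index 0 at most [1 / n],
   which leaves a nonnegative weight for [e_0]. *)
have /choice[ct ctP] (i : 'I_n.+1) : exists ct : rat * rat,
    [/\ ct.1 ^+ 2 * d 0 0 + ct.2 ^+ 2 * d 0 i = d 0 0,
        ct.1 ^+ 2 <= n.+1%:R^-1 \/ i = 0 & i = 0 -> ct = (1, 0)].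
  have [->|i_neq0] := eqVneq i 0.
    exists (1, 0); split => //=; last by right.
    by rewrite expr0n /= mul0r addr0 expr1n mul1r.
  have q_gt0 : 0 < d 0 i / d 0 0 by rewrite divr_gt0.
  have e_gt0 : 0 < n.+1%:R^-1 :> rat by rewrite invr_gt0.
  have [c [t [ct1 ce]]] := rational_ellipse_point R q_gt0 e_gt0.
  exists (c, t); split => /= [||i0]; [|by left|by rewrite i0 eqxx in i_neq0].
  rewrite -[RHS]mul1r -ct1; field; exact: d_neq0.
pose c i := (ct i).1; pose t i := (ct i).2.
have c0 : c 0 = 1 by rewrite /c; have [_ _ ->] := ctP 0.
have t0 : t 0 = 0 by rewrite /t; have [_ _ ->] := ctP 0.
have ctE i : c i ^+ 2 * d 0 0 + t i ^+ 2 * d 0 i = d 0 0 by have [] := ctP i.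
(* [tau i] and [1 - tau i] are the shares of [e_i] and of [e_0] in the squared
   length of the vectors of index [i]; the weights [w i] give the right total to
   each axis [i != 0], and the rest goes to [e_0] itself. *)
pose tau i := t i ^+ 2 * d 0 i / d 0 0.
have tauE i : tau i = 1 - c i ^+ 2.
  by rewrite /tau -[t i ^+ 2 * _](addKr (c i ^+ 2 * d 0 0)) ctE; field.
have tau_ge i : i != 0 -> n%:R <= n.+1%:R * tau i.
  move=> i_neq0; have [_ [ci|i0] _] := ctP i; last by rewrite i0 eqxx in i_neq0.
  rewrite tauE mulrBr mulr1 -[X in X - _]natr1 -addrA lerDl subr_ge0.
  by rewrite mulrC -ler_pdivlMr // div1r.
have n_gt0 i : i != 0 :> 'I_n.+1 -> 0 < n%:R :> rat.
  by rewrite ltr0n; case: (n) i => // i; rewrite ord1 eqxx.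
have tau_gt0 i : i != 0 -> 0 < tau i.
  move=> i_neq0; rewrite -(pmulr_rgt0 _ N_gt0).
  exact: lt_le_trans (n_gt0 i i_neq0) (tau_ge i i_neq0).
pose v i := (n.+1%:R * tau i)^-1.
pose w i := if i == 0 then 1 - \sum_(k | k != 0) v k else v i.
have v_le i : i != 0 -> n%:R * v i <= 1.
  move=> i_neq0; rewrite /v ler_pdivrMr ?mul1r ?tau_ge //.
  by rewrite mulr_gt0 ?tau_gt0.
have v_ge0 i : i != 0 -> 0 <= v i.
  by move=> i_neq0; rewrite invr_ge0 mulr_ge0 ?(ltW N_gt0) // ltW ?tau_gt0.
have card_neq0 : #|[pred k : 'I_n.+1 | k != 0]| = n.
  by rewrite (@eq_card _ _ (predC1 0)) ?cardC1 ?card_ord.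
have w_ge0 i : 0 <= w i.
  rewrite /w; case: ifPn => [_|]; last exact: v_ge0.
  rewrite subr_ge0; have [n0|n_neq0] := eqVneq n 0%N.
    rewrite big1 ?ler01 // => k; move/n_gt0; by rewrite n0 ltxx.
  have n_pos : 0 < n%:R :> rat by rewrite ltr0n lt0n.
  rewrite -(ler_pM2l n_pos) mulr1 mulr_sumr.
  rewrite -[leRHS](_ : \sum_(k : 'I_n.+1 | k != 0) 1 = _); first exact: ler_sum.
  by rewrite sumr_const card_neq0.
have wt i : i != 0 -> w i * t i ^+ 2 * d 0 i = d 0 0 / n.+1%:R.
  move=> i_neq0; rewrite /w (negPf i_neq0) /v.
  have -> : t i ^+ 2 = tau i * d 0 0 / d 0 i.
    by rewrite /tau; field; rewrite !d_neq0.
  by field; rewrite nat1r d_neq0 N_neq0 gt_eqF ?tau_gt0.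
(* With [c i ^+ 2 = 1 - tau i], the sum is 1 minus the [n] terms [v i * tau i], each equal to
   [1 / (n + 1)]. *)
have wc : \sum_i w i * c i ^+ 2 = n.+1%:R^-1.
  rewrite (bigD1 0) //= {1}/w eqxx c0 expr1n mulr1.
  have -> : \sum_(i < n.+1 | i != 0) w i * c i ^+ 2 =
      \sum_(k < n.+1 | k != 0) v k - \sum_(k < n.+1 | k != 0) n.+1%:R^-1.
    rewrite -sumrB; apply: eq_bigr => i i_neq0; rewrite /w (negPf i_neq0) /v.
    have -> : c i ^+ 2 = 1 - tau i by rewrite tauE; ring.
    by field; rewrite nat1r N_neq0 gt_eqF ?tau_gt0.
  rewrite sumr_const card_neq0 -mulr_natl subrKA.
  by field; rewrite nat1r.
(* Row [i] is [c i e_0 + s t i e_i]. Using both signs of [s] with half the weight each cancels the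
   cross terms between [e_0] and [e_i]. *)
pose X (s : rat) : 'M[rat]_n.+1 :=
  \matrix_(i, j) (c i * (j == 0)%:R + s * (t i * (i == j)%:R)).
exists (n.+1 + n.+1)%N, (col_mx (X 1) (X (-1))).
exists (row_mx (\row_i (w i / 2)) (\row_i (w i / 2))).
split => //.
- move=> j; case: (split_ordP j) => k ->;
  by rewrite ?row_mxEl ?row_mxEr !mxE divr_ge0.
- have Xd s : s ^+ 2 = 1 -> forall k, (X s *m diag_mx d *m (X s)^T) k k = d 0 0.
    move=> s2 k; rewrite mul_mx_diag !mxE.
    have [->|k_neq0] := eqVneq k 0.
      rewrite (bigD1 0) //= big1 => [|j j_neq0]; rewrite !mxE c0 t0 ?eqxx.
        by rewrite !mulr1n; ring.
      by rewrite (negPf j_neq0) !mulr0n; ring.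
    rewrite (bigD1 0) //= (bigD1 k) //= big1 => [|j /andP[j_neq0 j_neqk]].
      rewrite -[RHS](ctE k) -[t k ^+ 2 * _]mul1r -s2.
      by rewrite !mxE !eqxx (negPf k_neq0) !mulr1n !mulr0n; ring.
    by rewrite !mxE (negPf j_neq0) eq_sym (negPf j_neqk) !mulr0n; ring.
  move=> j; rewrite mul_col_mx tr_col_mx mul_col_row.
  case: (split_ordP j) => k ->.
    by rewrite block_mxEul Xd ?expr1n.
  by rewrite block_mxEdr Xd ?sqrrN ?expr1n.
- rewrite tr_col_mx diag_mx_row mul_row_block !mulmx0 addr0 add0r mul_row_col.
  apply/matrixP => a b; rewrite !mul_mx_diag !mxE -big_split /=.
  have -> : \sum_(i < n.+1)
      ((\matrix_(i, j) ((X 1)^T i j * (\row_j (w j / 2)) 0 j)) a i * X 1 i b +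
       (\matrix_(i, j) ((X (-1))^T i j * (\row_j (w j / 2)) 0 j)) a i *
       X (-1) i b) =
      (\sum_i w i * c i ^+ 2) * ((a == 0)%:R * (b == 0)%:R) +
      \sum_i w i * t i ^+ 2 * ((i == a)%:R * (i == b)%:R).
    rewrite mulr_suml -big_split /=; apply: eq_bigr => i _.
    by rewrite !mxE; field.
  rewrite wc [X in _ + X](bigD1 a) //= big1 => [|i /negPf->]; last first.
    by rewrite mul0r mulr0.
  rewrite addr0 eqxx; have [<-|a_neqb] := eqVneq a b; last first.
    rewrite mulr0n !mulr0 addr0; have [a0|_] := eqVneq a 0; last first.
      by rewrite mul0r mulr0 mul0r.
    by rewrite -a0 eq_sym (negPf a_neqb) !mulr0 mul0r.
  have [->|a_neq0] := eqVneq a 0.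
    by rewrite t0 expr0n /= mulr0 mul0r addr0 !mulr1 mulrC.
  by rewrite mul0r mulr0 add0r !mulr1 wt.
Qed.

Lemma clear_denominators (m n : nat) (M : 'M[rat]_(m, n)) :
  exists2 N : int, 0 < N &
  exists Z : 'M[int]_(m, n), N%:~R *: M = map_mx intr Z.
Proof.
pose rest i j := \prod_(k : 'I_m * 'I_n | k != (i, j)) denq (M k.1 k.2).
exists (\prod_(k : 'I_m * 'I_n) denq (M k.1 k.2)).
  by apply: prodr_gt0 => k _; exact: denq_gt0.
exists (\matrix_(i, j) (rest i j * numq (M i j))).
apply/matrixP => i j; rewrite !mxE (bigD1 (i, j)) //= -/(rest i j).
rewrite !intrM numqE; ring.
Qed.

(** The diagonal design is carried to [A] by the change of basis [P], then scaled by a common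
    denominator [N]. When [A] is a Gram matrix, integrality of [Y *m A] puts the vectors with
    coordinates [Y] in the dual lattice. *)
Lemma integral_design (R : realType) (n : nat) (A : 'M[rat]_n.+1) :
  A^T = A -> (forall x : 'rV[rat]_n.+1, x != 0 -> 0 < (x *m A *m x^T) 0 0) ->
  exists (p : nat) (Y : 'M[rat]_(p.+1, n.+1)) (Z : 'M[int]_(p.+1, n.+1))
      (w : 'rV[rat]_p.+1) (r : rat),
    [/\ 0 < r, Y *m A = map_mx intr Z, forall j, 0 <= w 0 j,
        forall j, (Y *m A *m Y^T) j j = r
      & Y^T *m diag_mx w *m Y *m A = (r / n.+1%:R)%:M].
Proof.
move=> sA pA; have [P [d [P_unit d_gt0 PE]]] := posdef_diagonalization sA pA.
have [p [Y [w [p_gt0 w_ge0 Yd YwY]]]] := diagonal_design R d_gt0.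
case: p Y w p_gt0 w_ge0 Yd YwY => // p Y w _ w_ge0 Yd YwY.
have [N N_gt0 [Z NZ]] := clear_denominators (Y *m P *m A).
(* This turns the weighted sum of squares times [A] into a conjugate, by [P^T], of the scalar matrix
   in [YwY]. *)
have PA : P *m A = diag_mx d *m invmx P^T by rewrite -PE mulmxK ?unitmx_tr.
have trZ k l (a : rat) (M : 'M[rat]_(k, l)) : (a *: M)^T = a *: M^T.
  by rewrite linearZ.
exists p, (N%:~R *: (Y *m P)), Z, w, (N%:~R ^+ 2 * d 0 0); split => //.
- by rewrite mulr_gt0 // exprn_gt0 // ltr0z.
- by rewrite -scalemxAl.
- move=> j; rewrite trZ -!scalemxAl -scalemxAr scalerA trmx_mul.
  by rewrite !mulmxA -2!(mulmxA Y) -expr2 PE mxE Yd.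
- rewrite trZ -!scalemxAl -scalemxAr -!scalemxAl scalerA -expr2 trmx_mul.
  rewrite mulmxA -[X in _ *: X]mulmxA PA !mulmxA -3!(mulmxA P^T) YwY.
  rewrite mul_mx_scalar -scalemxAl mulmxV ?unitmx_tr //.
  by rewrite scalemx1 scale_scalar_mx mulrA.
Qed.

(** * From a rational Gram matrix to the immersion *)

Lemma dotv_gt0 (R : realType) (n : nat) (y : 'rV[R]_n) : y != 0 -> 0 < dotv y y.
Proof.
have -> : dotv y y = \sum_i y 0 i ^+ 2.
  by rewrite /dotv mxE; apply: eq_bigr => i _; rewrite mxE.
have y2_ge0 i : true -> 0 <= y 0 i ^+ 2 by rewrite sqr_ge0.
rewrite lt_def sumr_ge0 // andbT; apply: contra_neq => y0.
apply/rowP => i; rewrite [RHS]mxE; apply/eqP; rewrite -sqrf_eq0.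
by rewrite (psumr_eq0P y2_ge0 y0).
Qed.

Theorem theorem1 (R : realType) (n : nat) (hn : (0 < n)%N)
    (Lam : zmodClosed 'rV[R]_n) (hLam : is_lattice Lam)
    (hrat : rational_lattice Lam) :
  exists (lam : R) (m : nat),
    [/\ 0 < lam, (0 < m)%N &
      exists f : flat_torus (dilation lam Lam) -> 'rV[R]_m.+1,
        minimal_isometric_immersion f].
Proof.
case: n hn Lam hLam hrat => // n _ Lam _ [L [L_unit LamL] [c c_gt0 [A LA]]].
have c_neq0 : c != 0 by rewrite gt_eqF.
have LAi : L *m L^T = c^-1 *: map_mx ratr A.
  by rewrite -LA scalerA mulVf ?scale1r.
have sA : A^T = A.
  apply: (@map_mx_inj _ _ (ratr : rat -> R)).
  by rewrite -matrix.map_trmx -LA linearZ /= /gram trmx_mul trmxK.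
(* The form [A] at [x] is [c] times the squared length of the vector with coordinates [x] in the
   basis [L]. *)
have pA (x : 'rV[rat]_n.+1) : x != 0 -> 0 < (x *m A *m x^T) 0 0.
  move=> x_neq0; pose y := map_mx ratr x *m L.
  have y_neq0 : y != 0.
    apply: contra_neq x_neq0 => /(congr1 (mulmx^~ (invmx L))).
    by rewrite mul0mx mulmxK // => /eqP; rewrite map_mx_eq0 => /eqP.
  rewrite -(ltr0q R).
  have -> : ratr ((x *m A *m x^T) 0 0) = c * dotv y y.
    rewrite /dotv /y trmx_mul mulmxA -(mulmxA _ L) -/(gram L).
    rewrite [gram L]LAi -scalemxAr -scalemxAl [X in c * X]mxE mulVKf //.
    by rewrite matrix.map_trmx -!map_mxM [RHS]mxE.
  by rewrite mulr_gt0 ?dotv_gt0.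
have [p [Y [Z [w [r [r_gt0 YZ w_ge0 Yr YwY]]]]]] := integral_design R sA pA.
(* The rows of [YR *m L] have squared length [r / c]; scaling by [mu] makes it [n.+1], the required
   eigenvalue. *)
pose mu := Num.sqrt (n.+1%:R * c / ratr r).
have rho_gt0 : 0 < ratr r :> R by rewrite ltr0q.
have r_neq0 : ratr r != 0 :> R by rewrite gt_eqF.
have mu2_gt0 : 0 < n.+1%:R * c / ratr r :> R.
  by apply: divr_gt0 rho_gt0; rewrite mulr_gt0 ?ltr0n.
have mu2 : mu ^+ 2 = n.+1%:R * c / ratr r by rewrite sqr_sqrtr // ltW.
have mu_gt0 : 0 < mu by rewrite sqrtr_gt0.
pose YR : 'M[R]_(p.+1, n.+1) := map_mx ratr Y.
pose K : 'M[R]_(n.+1, p.+1) := mu *: (L^T *m YR^T).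
pose a : 'rV[R]_p.+1 := \row_j Num.sqrt (ratr (w 0 j)).
have a2 j : a 0 j ^+ 2 = ratr (w 0 j) by rewrite mxE sqr_sqrtr // ler0q.
have LT_unit : L^T \in unitmx by rewrite unitmx_tr.
have KT : K^T = mu *: (YR *m L) by rewrite linearZ /= trmx_mul !trmxK.
have KK j : \sum_i K i j ^+ 2 = n.+1%:R.
  have -> : \sum_i K i j ^+ 2 = (K^T *m K) j j.
    by rewrite mxE; apply: eq_bigr => i _; rewrite [in RHS]mxE expr2.
  rewrite KT /K -scalemxAl -scalemxAr scalerA -expr2 mu2 !mulmxA.
  rewrite -(mulmxA YR) LAi -scalemxAr -scalemxAl scalerA mxE.
  rewrite /YR matrix.map_trmx -!map_mxM mxE Yr; field.
  by rewrite r_neq0 c_neq0.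
have aK i i' : \sum_j a 0 j ^+ 2 * K i j * K i' j = (i == i')%:R.
  have -> : \sum_j a 0 j ^+ 2 * K i j * K i' j =
      (K *m diag_mx (map_mx ratr w) *m K^T) i i'.
    rewrite mul_mx_diag mxE; apply: eq_bigr => j _.
    by rewrite a2 [in RHS]mxE [K^T _ _]mxE [map_mx _ _ _ _]mxE; ring.
  suff -> : K *m diag_mx (map_mx ratr w) *m K^T = 1%:M by rewrite mxE.
  (* Multiplying by the invertible [L^T] makes [L *m L^T], hence [A], appear, so that [YwY]
     applies. *)
  have KWK : K *m diag_mx (map_mx ratr w) *m K^T *m L^T = 1%:M *m L^T.
    rewrite KT /K -!scalemxAl -scalemxAr -!scalemxAl scalerA -expr2 mu2.
    rewrite !mulmxA -[_ *m L *m L^T]mulmxA LAi -scalemxAr scalerA.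
    have YwYr : YR^T *m diag_mx (map_mx ratr w) *m YR *m map_mx ratr A =
        (ratr (r / n.+1%:R))%:M.
      by rewrite /YR matrix.map_trmx -map_diag_mx -!map_mxM YwY map_scalar_mx.
    rewrite -3!(mulmxA L^T) YwYr mul_mx_scalar scalerA mul1mx -[RHS]scale1r.
    congr (_ *: _); rewrite fmorph_div /= ratr_nat.
    by field; rewrite nat1r pnatr_eq0 c_neq0 r_neq0.
  by rewrite -[LHS](mulmxK LT_unit) KWK mulmxK.
(* A lattice vector with coordinates [z], scaled by [lam], pairs with the frequencies to
   [lam * mu / c] times the integral row [z *m Z^T]; this [lam] makes the factor [2 pi]. *)
have KLam v : v \in dilation (pi *+ 2 * c / mu) Lam ->
    forall j, exists z : int, (v *m K) 0 j = pi *+ 2 *~ z.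
  move=> /asboolP[u /LamL[z ->] ->] j; exists ((z *m Z^T) 0 j).
  have -> : (pi *+ 2 * c / mu) *: (map_mx intr z *m L) *m K =
      (pi *+ 2) *: map_mx intr (z *m Z^T).
    rewrite /K -scalemxAl -scalemxAr scalerA mulmxA -(mulmxA _ L) LAi.
    rewrite -scalemxAr -scalemxAl scalerA -mulmxA.
    have -> : map_mx ratr A *m YR^T = map_mx intr Z^T.
      rewrite /YR matrix.map_trmx -map_mxM -sA -trmx_mul YZ -!matrix.map_trmx.
      by apply/matrixP => k l; rewrite !mxE rmorph_int.
    rewrite -map_mxM; congr (_ *: _).
    by field; rewrite c_neq0 gt_eqF.

  by rewrite !mxE mulrzr.
exists (pi *+ 2 * c / mu), (p + p.+1)%N; split; last 1 first.
- exact: circle_wave_minimal_isometric_immersion aK KK KLam.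
- by apply: divr_gt0 mu_gt0; rewrite mulr_gt0 // pmulrn_lgt0 // pi_gt0.
- by rewrite addnS.
Qed.
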